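(* Let $F:(\Sigma_1,\mathscr R_1)\to(\Sigma_2,\mathscr R_2)$ be a theory morphism between Dedukti theories. (1) If $\Sigma_1;\Gamma$ is well-formed then $\Sigma_2;|\Gamma|_F$ is well-formed. (2) If $\Sigma_1;\Gamma\vdash_1M:A$ then $\Sigma_2;|\Gamma|_F\vdash_2|M|_F:|A|_F$.
   Context: Dedukti: terms $x\mid c[\vec M]\mid\mathtt{TYPE}\mid\mathtt{KIND}\mid MN\mid\lambda x:A.M\mid\Pi x:A.B$ (constants with fixed arity), signatures of declarations $c[\Delta_c]:A_c$, rewrite rules $c[\vec l]\hookrightarrow r$; in theory $(\Sigma_i,\mathscr R_i)$, $\hookrightarrow_i$ is $\beta$ plus context/substitution closure of $\mathscr R_i$, $\equiv_i$ its equivalence, and $\vdash_i$ typing given by: Empty; Decl ($A:\mathtt{TYPE}$, $x\notin\Gamma$); Cons ($c[\Delta]:A\in\Sigma_i$, $\Delta\vdash A:s$, arguments typed sequentially against $\Delta$ give $c[\vec M]:A\{\vec M\}$); Sort ($\mathtt{TYPE}:\mathtt{KIND}$); Var; Conv (modulo $\equiv_i$, target of sort $s\in\{\mathtt{TYPE},\mathtt{KIND}\}$); Prod ($A:\mathtt{TYPE}$, $x:A\vdash B:s$); App; Abs. A theory pre-morphism $F$ assigns to each constant $c$ of $\Sigma_1$ a term $F_c$ over constants of $\Sigma_2$ with free variables among those of $\Delta_c$; it induces $|c[\vec M]|_F=F_c\{|\vec M|_F\}$ (substituting the arguments for the variables of $\Delta_c$), $|x|_F=x$, $|\mathtt{TYPE}|_F=\mathtt{TYPE}$,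 $|\mathtt{KIND}|_F=\mathtt{KIND}$, $|\Pi x:A.B|_F=\Pi x:|A|_F.|B|_F$, $|\lambda x:A.M|_F=\lambda x:|A|_F.|M|_F$, $|MN|_F=|M|_F|N|_F$, componentwise on contexts. $F$ is a theory morphism if (i) for each $c[\Delta_c]:A_c\in\Sigma_1$, $\Sigma_2;|\Delta_c|_F\vdash_2F_c:|A_c|_F$, and (ii) for each rule $l\hookrightarrow r\in\mathscr R_1$, $|l|_F\hookrightarrow_2^*|r|_F$. *)

(* Defs.v *)
From mathcomp Require Import all_boot.
From Stdlib Require Import Relation_Operators.

Set Implicit Arguments.
Unset Strict Implicit.
Unset Printing Implicit Defensive.

(* Terms are taken modulo alpha-conversion, as well-scoped de Bruijn terms:
   [tm K n] is the type of the terms over the constants of [K] whose free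
   variables are among n variables; the variable [ord0] is the innermost one. *)

Record constants := Constants {
  const :> Type;
  arity : const -> nat }.

Inductive dksort := stype | skind.

(* A list of arguments [M_1, ..., M_k] for a constant of arity k is a function
   on ['I_k]. It is indexed like the variables x_1, ..., x_k that it replaces:
   the value at [ord0] is the last argument M_k. An argument list is thus
   literally the substitution {M_1/x_1, ..., M_k/x_k}. *)
Inductive tm (K : constants) (n : nat) : Type :=
| Var of 'I_n
| Cst (c : K) of ('I_(arity c) -> tm K n)
| Srt of dksort
| App of tm K n & tm K n
| Lam of tm K n & tm K n.+1
| Pi of tm K n & tm K n.+1.

Arguments Var {K n} _.
Arguments Cst {K n} c _.
Arguments Srt {K n} _.

Definition TYPE {K n} : tm K n := Srt stype.
Definition KIND {K n} : tm K n := Srt skind.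

Definition scons (T : Type) n (t : T) (f : 'I_n -> T) (i : 'I_n.+1) : T :=
  if unlift ord0 i is Some j then f j else t.

Definition up_ren n m (r : 'I_n -> 'I_m) : 'I_n.+1 -> 'I_m.+1 :=
  scons ord0 (fun i => lift ord0 (r i)).

Fixpoint rename K n m (r : 'I_n -> 'I_m) (M : tm K n) : tm K m :=
  match M with
  | Var x => Var (r x)
  | Cst c l => Cst c (fun i => rename r (l i))
  | Srt s => Srt s
  | App P Q => App (rename r P) (rename r Q)
  | Lam A P => Lam (rename r A) (rename (up_ren r) P)
  | Pi A B => Pi (rename r A) (rename (up_ren r) B)
  end.

Definition shift K n : tm K n -> tm K n.+1 := rename (lift ord0).

Definition up K n m (s : 'I_n -> tm K m) : 'I_n.+1 -> tm K m.+1 :=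
  scons (Var ord0) (fun i => shift (s i)).

Fixpoint subst K n m (s : 'I_n -> tm K m) (M : tm K n) : tm K m :=
  match M with
  | Var x => s x
  | Cst c l => Cst c (fun i => subst s (l i))
  | Srt t => Srt t
  | App P Q => App (subst s P) (subst s Q)
  | Lam A P => Lam (subst s A) (subst (up s) P)
  | Pi A B => Pi (subst s A) (subst (up s) B)
  end.

Definition subst1 K n (N : tm K n) (M : tm K n.+1) : tm K n :=
  subst (scons N Var) M.

Inductive ctx (K : constants) : nat -> Type :=
| Empty : ctx K 0
| Snoc n : ctx K n -> tm K n -> ctx K n.+1.

Arguments Empty {K}.

(* The type of a variable, weakened to the whole context. The function given
   for [Empty] has domain ['I_0]. *)
Fixpoint lookup K n (G : ctx K n) : 'I_n -> tm K n :=
  match G in ctx _ n return 'I_n -> tm K n with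
  | Empty => Var
  | Snoc _ G A => fun i => shift (scons A (lookup G) i)
  end.

(* Every constant of [sig_consts] is declared, and the declaration of [c] is
   c[decl_ctx c] : decl_type c. *)
Record signature := Signature {
  sig_consts :> constants;
  decl_ctx : forall c : sig_consts, ctx sig_consts (arity c);
  decl_type : forall c : sig_consts, tm sig_consts (arity c) }.

(* [rules n c l r] means that c[l] --> r is a rule, with free variables among
   n variables. *)
Record theory := Theory {
  sgn :> signature;
  rules : forall (n : nat) (c : sgn),
    ('I_(arity c) -> tm sgn n) -> tm sgn n -> Prop }.

Inductive red (T : theory) : forall n, tm T n -> tm T n -> Prop :=
| red_beta n (A : tm T n) M N : red (App (Lam A M) N) (subst1 N M)
| red_rule k (c : T) (l : 'I_(arity c) -> tm T k) (r : tm T k)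
    n (s : 'I_k -> tm T n) :
    rules l r -> red (subst s (Cst c l)) (subst s r)
| red_cst n (c : T) (l l' : 'I_(arity c) -> tm T n) (i : 'I_(arity c)) :
    red (l i) (l' i) -> (forall j, j != i -> l' j = l j) ->
    red (Cst c l) (Cst c l')
| red_appl n (M M' N : tm T n) : red M M' -> red (App M N) (App M' N)
| red_appr n (M N N' : tm T n) : red N N' -> red (App M N) (App M N')
| red_laml n (A A' : tm T n) M : red A A' -> red (Lam A M) (Lam A' M)
| red_lamr n (A : tm T n) M M' : red M M' -> red (Lam A M) (Lam A M')
| red_pil n (A A' : tm T n) B : red A A' -> red (Pi A B) (Pi A' B)
| red_pir n (A : tm T n) B B' : red B B' -> red (Pi A B) (Pi A B').

Definition reds (T : theory) n : tm T n -> tm T n -> Prop :=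
  clos_refl_trans _ (@red T n).

Definition conv (T : theory) n : tm T n -> tm T n -> Prop :=
  clos_refl_sym_trans _ (@red T n).

(* [args G l D] says that M_1, ..., M_k are typed sequentially against
   D = x_1 : A_1, ..., x_k : A_k, that is
   G |- M_i : A_i{M_1/x_1, ..., M_(i-1)/x_(i-1)} for each i. For k = 0 it
   requires [G] to be well-formed, so that a nullary constant is typed in
   well-formed contexts only. *)
Inductive wf (T : theory) : forall n, ctx T n -> Prop :=
| wf_empty : wf Empty
| wf_decl n (G : ctx T n) A : typ G A TYPE -> wf (Snoc G A)
with typ (T : theory) : forall n, ctx T n -> tm T n -> tm T n -> Prop :=
| typ_cons n (G : ctx T n) (c : T) (l : 'I_(arity c) -> tm T n) s :
    typ (decl_ctx c) (decl_type c) (Srt s) -> args G l (decl_ctx c) ->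
    typ G (Cst c l) (subst l (decl_type c))
| typ_sort n (G : ctx T n) : wf G -> typ G TYPE KIND
| typ_var n (G : ctx T n) x : wf G -> typ G (Var x) (lookup G x)
| typ_conv n (G : ctx T n) M A B s :
    typ G M A -> typ G B (Srt s) -> conv A B -> typ G M B
| typ_prod n (G : ctx T n) A B s :
    typ G A TYPE -> typ (Snoc G A) B (Srt s) -> typ G (Pi A B) (Srt s)
| typ_app n (G : ctx T n) M N A B :
    typ G M (Pi A B) -> typ G N A -> typ G (App M N) (subst1 N B)
| typ_abs n (G : ctx T n) A B M s :
    typ G A TYPE -> typ (Snoc G A) B (Srt s) -> typ (Snoc G A) M B ->
    typ G (Lam A M) (Pi A B)
with args (T : theory) :
    forall n, ctx T n -> forall k, ('I_k -> tm T n) -> ctx T k -> Prop :=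
| args_empty n (G : ctx T n) (l : 'I_0 -> tm T n) : wf G -> args G l Empty
| args_snoc n (G : ctx T n) k (l : 'I_k.+1 -> tm T n) (D : ctx T k) A :
    args G (fun i => l (lift ord0 i)) D ->
    typ G (l ord0) (subst (fun i => l (lift ord0 i)) A) ->
    args G l (Snoc D A).

Definition premorphism (K1 K2 : constants) :=
  forall c : K1, tm K2 (arity c).

Fixpoint tr K1 K2 (F : premorphism K1 K2) n (M : tm K1 n) : tm K2 n :=
  match M with
  | Var x => Var x
  | Cst c l => subst (fun i => tr F (l i)) (F c)
  | Srt s => Srt s
  | App P Q => App (tr F P) (tr F Q)
  | Lam A P => Lam (tr F A) (tr F P)
  | Pi A B => Pi (tr F A) (tr F B)
  end.

Fixpoint tr_ctx K1 K2 (F : premorphism K1 K2) n (G : ctx K1 n) : ctx K2 n :=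
  match G with
  | Empty => Empty
  | Snoc _ G A => Snoc (tr_ctx F G) (tr F A)
  end.

Record morphism (T1 T2 : theory) (F : premorphism T1 T2) : Prop := Morphism {
  morphism_typ : forall c : T1,
    typ (tr_ctx F (decl_ctx c)) (F c) (tr F (decl_type c));
  morphism_red : forall n (c : T1) (l : 'I_(arity c) -> tm T1 n) (r : tm T1 n),
    rules l r -> reds (tr F (Cst c l)) (tr F r) }.

(* Main.v *)
From mathcomp Require Import all_boot.
From Stdlib Require Import Relation_Operators FunctionalExtensionality.
Require Import Defs.

Set Implicit Arguments.
Unset Strict Implicit.
Unset Printing Implicit Defensive.

(** The translation commutes with substitution, so it maps a rule instance to
    an instance of the reduction that the morphism provides, and a reduction
    inside an argument of [c] to as many reductions as the variable occurs in
    [F c]; hence it preserves conversion. A derivation is then translated rule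
    by rule: the constant rule is an instance of the substitution lemma of the
    target theory, applied to the typing of [F c] and the translated
    arguments. *)

(** * Substitution calculus *)

Lemma scons0 (T : Type) n (t : T) (f : 'I_n -> T) : scons t f ord0 = t.
Proof. by rewrite /scons unlift_none. Qed.

Lemma scons_lift (T : Type) n (t : T) (f : 'I_n -> T) i :
  scons t f (lift ord0 i) = f i.
Proof. by rewrite /scons liftK. Qed.

Lemma ord_case n (P : 'I_n.+1 -> Prop) :
  P ord0 -> (forall i, P (lift ord0 i)) -> forall i, P i.
Proof. by move=> P0 PS i; case: (unliftP ord0 i) => [j|] ->. Qed.

(** [up] and [up_ren] unfold to [scons], so each law on lifted maps reduces to a check at the new
    variable and one at the shifted variables. *)
Lemma eq_scons (T : Type) n (t : T) (f : 'I_n -> T) (g : 'I_n.+1 -> T) :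
  g ord0 = t -> (forall i, g (lift ord0 i) = f i) -> scons t f = g.
Proof.
move=> g0 gS; apply: functional_extensionality; apply: ord_case.
  by rewrite scons0.
by move=> i; rewrite scons_lift.
Qed.

(** First of four composition laws. In each, the binder case needs [E]: lifting commutes with
    composition. For [rename_subst] and [subst_subst], [E] relies on how the outer map passes a
    shift, which comes from the earlier laws. *)
Lemma rename_rename K n (M : tm K n) m p (r : 'I_n -> 'I_m) (r' : 'I_m -> 'I_p) :
  rename r' (rename r M) = rename (fun i => r' (r i)) M.
Proof.
have E n' m' p' (q : 'I_n' -> 'I_m') (q' : 'I_m' -> 'I_p') :
    up_ren (fun i => q' (q i)) = fun i => up_ren q' (up_ren q i).
  apply: eq_scons => [|i]; first by rewrite /up_ren !scons0.
  by rewrite /up_ren !scons_lift.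
elim: M m p r r' => {n} //= [n c l IH|n P IHP Q IHQ|n A IHA P IHP|n A IHA P IHP]
  m p r r'.
- by congr (Cst c _); apply: functional_extensionality => i.
- by rewrite IHP IHQ.
- by rewrite IHA IHP (E _ _ _ r r').
- by rewrite IHA IHP (E _ _ _ r r').
Qed.

Lemma rename_up_shift K n m (r : 'I_n -> 'I_m) (M : tm K n) :
  rename (up_ren r) (shift M) = shift (rename r M).
Proof.
rewrite /shift !rename_rename; congr rename.
by apply: functional_extensionality => i; rewrite /up_ren scons_lift.
Qed.

Lemma subst_rename K n (M : tm K n) m p (r : 'I_n -> 'I_m) (s : 'I_m -> tm K p) :
  subst s (rename r M) = subst (fun i => s (r i)) M.
Proof.
have E n' m' p' (q : 'I_n' -> 'I_m') (t : 'I_m' -> tm K p') :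
    up (fun i => t (q i)) = fun i => up t (up_ren q i).
  apply: eq_scons => [|i]; first by rewrite /up_ren /up !scons0.
  by rewrite /up_ren /up !scons_lift.
elim: M m p r s => {n} //= [n c l IH|n P IHP Q IHQ|n A IHA P IHP|n A IHA P IHP]
  m p r s.
- by congr (Cst c _); apply: functional_extensionality => i.
- by rewrite IHP IHQ.
- by rewrite IHA IHP (E _ _ _ r s).
- by rewrite IHA IHP (E _ _ _ r s).
Qed.

Lemma rename_subst K n (M : tm K n) m p (s : 'I_n -> tm K m) (r : 'I_m -> 'I_p) :
  rename r (subst s M) = subst (fun i => rename r (s i)) M.
Proof.
have E n' m' p' (t : 'I_n' -> tm K m') (q : 'I_m' -> 'I_p') :
    up (fun i => rename q (t i)) = fun i => rename (up_ren q) (up t i).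
  apply: eq_scons => [|i]; first by rewrite /up scons0 /= /up_ren scons0.
  by rewrite /up scons_lift rename_up_shift.
elim: M m p s r => {n} //= [n c l IH|n P IHP Q IHQ|n A IHA P IHP|n A IHA P IHP]
  m p s r.
- by congr (Cst c _); apply: functional_extensionality => i.
- by rewrite IHP IHQ.
- by rewrite IHA IHP (E _ _ _ s r).
- by rewrite IHA IHP (E _ _ _ s r).
Qed.

Lemma subst_up_shift K n m (s : 'I_n -> tm K m) (M : tm K n) :
  subst (up s) (shift M) = shift (subst s M).
Proof.
rewrite /shift subst_rename rename_subst; congr subst.
by apply: functional_extensionality => i; rewrite /up scons_lift.
Qed.

Lemma subst_subst K n (M : tm K n) m p (s : 'I_n -> tm K m) (t : 'I_m -> tm K p) :
  subst t (subst s M) = subst (fun i => subst t (s i)) M.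
Proof.
have E n' m' p' (s' : 'I_n' -> tm K m') (t' : 'I_m' -> tm K p') :
    up (fun i => subst t' (s' i)) = fun i => subst (up t') (up s' i).
  apply: eq_scons => [|i]; first by rewrite /up scons0 /= scons0.
  by rewrite /up scons_lift subst_up_shift.
elim: M m p s t => {n} //= [n c l IH|n P IHP Q IHQ|n A IHA P IHP|n A IHA P IHP]
  m p s t.
- by congr (Cst c _); apply: functional_extensionality => i.
- by rewrite IHP IHQ.
- by rewrite IHA IHP (E _ _ _ s t).
- by rewrite IHA IHP (E _ _ _ s t).
Qed.

Lemma subst_Var K n (M : tm K n) : subst Var M = M.
Proof.
have E n' : up (@Var K n') = Var by apply: eq_scons.
elim: M => {n} //= [n c l IH|n P -> Q ->|n A -> P IHP|n A -> P IHP] //.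
- by congr (Cst c _); apply: functional_extensionality => i.
- by rewrite E IHP.
- by rewrite E IHP.
Qed.

Lemma subst_scons_shift K n m (N : tm K m) (s : 'I_n -> tm K m) (M : tm K n) :
  subst (scons N s) (shift M) = subst s M.
Proof.
rewrite /shift subst_rename; congr subst.
by apply: functional_extensionality => i; rewrite scons_lift.
Qed.

Lemma subst_subst1 K n m (s : 'I_n -> tm K m) (N : tm K n) (M : tm K n.+1) :
  subst s (subst1 N M) = subst1 (subst s N) (subst (up s) M).
Proof.
rewrite /subst1 !subst_subst; congr subst.
apply: functional_extensionality; apply: ord_case => [|i].
  by rewrite /up !scons0 /= scons0.
by rewrite /up !scons_lift subst_scons_shift subst_Var.
Qed.

Lemma rename_as_subst K n (M : tm K n) m (r : 'I_n -> 'I_m) :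
  rename r M = subst (fun i => Var (r i)) M.
Proof. by rewrite -[in LHS](subst_Var M) rename_subst. Qed.

Lemma up_Var K n m (r : 'I_n -> 'I_m) :
  up (fun i => Var (r i)) = (fun i => Var (up_ren r i)) :> ('I_n.+1 -> tm K m.+1).
Proof.
by apply: eq_scons => [|i]; rewrite /up_ren ?scons0 ?scons_lift.
Qed.

Lemma rename_subst1 K n m (r : 'I_n -> 'I_m) (N : tm K n) (M : tm K n.+1) :
  rename r (subst1 N M) = subst1 (rename r N) (rename (up_ren r) M).
Proof. by rewrite !rename_as_subst subst_subst1 up_Var. Qed.

(** * Reduction *)

Section Reduction.
Variable T : theory.

Lemma reds_refl n (M : tm T n) : reds M M.
Proof. exact: rt_refl. Qed.

Lemma reds_trans n (M N P : tm T n) : reds M N -> reds N P -> reds M P.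
Proof. exact: rt_trans. Qed.

Lemma reds_map n m (f : tm T n -> tm T m) (M N : tm T n) :
  (forall P Q, red P Q -> reds (f P) (f Q)) -> reds M N -> reds (f M) (f N).
Proof.
move=> fP; elim=> [P Q /fP //|P|P Q S _ IH1 _ IH2]; first exact: reds_refl.
exact: reds_trans IH1 IH2.
Qed.

Lemma reds_App n (M M' N N' : tm T n) :
  reds M M' -> reds N N' -> reds (App M N) (App M' N').
Proof.
move=> rM rN; apply: (@reds_trans _ _ (App M' N)).
  apply: (reds_map (f := fun P => App P N)) rM => P Q rPQ.
  by apply: rt_step; apply: red_appl.
apply: reds_map rN => P Q rPQ.
by apply: rt_step; apply: red_appr.
Qed.

Lemma reds_Lam n (A A' : tm T n) M M' :
  reds A A' -> reds M M' -> reds (Lam A M) (Lam A' M').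
Proof.
move=> rA rM; apply: (@reds_trans _ _ (Lam A' M)).
  apply: (reds_map (f := fun P => Lam P M)) rA => P Q rPQ.
  by apply: rt_step; apply: red_laml.
apply: reds_map rM => P Q rPQ.
by apply: rt_step; apply: red_lamr.
Qed.

Lemma reds_Pi n (A A' : tm T n) B B' :
  reds A A' -> reds B B' -> reds (Pi A B) (Pi A' B').
Proof.
move=> rA rB; apply: (@reds_trans _ _ (Pi A' B)).
  apply: (reds_map (f := fun P => Pi P B)) rA => P Q rPQ.
  by apply: rt_step; apply: red_pil.
apply: reds_map rB => P Q rPQ.
by apply: rt_step; apply: red_pir.
Qed.

(* The arguments are reduced one position at a time. *)
Lemma reds_Cst n (c : T) (l l' : 'I_(arity c) -> tm T n) :
  (forall i, reds (l i) (l' i)) -> reds (Cst c l) (Cst c l').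
Proof.
(* The hybrid list [g k] has its positions below [k] already reduced; it runs from [l] at [0] to
   [l'] at [arity c]. *)
move=> rl; pose g k i := if (nat_of_ord i < k)%N then l' i else l i.
have gE k : (k <= arity c)%N -> reds (Cst c l) (Cst c (g k)).
  elim: k => [_|k IH lt_k].
    have -> : g 0%N = l by apply: functional_extensionality.
    exact: reds_refl.
  apply: reds_trans (IH (ltnW lt_k)) _; pose i := Ordinal lt_k.
  (* [f] is [g k] with a hole at position [k]: filling it with [l i] gives [g k], with [l' i] gives
     [g k.+1]. *)
  pose f P j := if j == i then P else g k j.
  have -> : g k = f (l i).
    apply: functional_extensionality => j; rewrite /f.
    by case: eqP => // ->; rewrite /g ltnn.
  have -> : g k.+1 = f (l' i).
    apply: functional_extensionality => j; rewrite /f /g ltnS leq_eqVlt.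
    have -> : (nat_of_ord j == k) = (j == i) by [].
    by case: eqP => //= ->.
  apply: (reds_map (f := fun P => Cst c (f P))) (rl i) => P Q rPQ.
  apply: rt_step; apply: (@red_cst _ _ _ _ _ i); first by rewrite /f eqxx.
  by move=> j /negbTE ji; rewrite /f ji.
suff <- : g (arity c) = l' by apply: gE.
by apply: functional_extensionality => i; rewrite /g ltn_ord.
Qed.

Lemma red_subst n (M N : tm T n) : red M N ->
  forall m (s : 'I_n -> tm T m), red (subst s M) (subst s N).
Proof.
elim=> {n M N} /=.
- by move=> n A M N m s; rewrite subst_subst1; apply: red_beta.
- move=> k c l r n s lr m t.
  (* A rule instance under [s], substituted by [t], is the instance of the same rule under the
     composite. *)
  rewrite [subst t (subst s r)]subst_subst.
  have -> : (fun i => subst t (subst s (l i))) =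
            (fun i => subst (fun j => subst t (s j)) (l i)).
    by apply: functional_extensionality => i; rewrite subst_subst.
  exact: (red_rule (fun j => subst t (s j)) lr).
- move=> n c l l' i _ IH E m s; apply: (@red_cst _ _ _ _ _ i) => // j /E.
  by move=> ->.
- by move=> *; apply: red_appl.
- by move=> *; apply: red_appr.
- by move=> *; apply: red_laml.
- by move=> *; apply: red_lamr.
- by move=> *; apply: red_pil.
- by move=> *; apply: red_pir.
Qed.

Lemma reds_subst n m (s : 'I_n -> tm T m) (M N : tm T n) :
  reds M N -> reds (subst s M) (subst s N).
Proof.
by apply: reds_map => P Q rPQ; apply: rt_step; apply: red_subst.
Qed.

Lemma reds_conv n (M N : tm T n) : reds M N -> conv M N.
Proof.
elim=> [P Q|P|P Q S _ IH1 _ IH2]; [exact: rst_step|exact: rst_refl|].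
exact: rst_trans IH1 IH2.
Qed.

Lemma conv_subst n m (s : 'I_n -> tm T m) (M N : tm T n) :
  conv M N -> conv (subst s M) (subst s N).
Proof.
elim=> [P Q /red_subst rPQ|P|P Q _|P Q S _ IH1 _ IH2].
- exact: rst_step.
- exact: rst_refl.
- exact: rst_sym.
- exact: rst_trans IH1 IH2.
Qed.

(** Each occurrence of a variable in [M] is reduced separately. Under a binder, [E] carries the
    hypothesis to the lifted substitutions, a shift being itself a substitution. *)
Lemma reds_subst_pointwise n (M : tm T n) m (s s' : 'I_n -> tm T m) :
  (forall i, reds (s i) (s' i)) -> reds (subst s M) (subst s' M).
Proof.
have E n' m' (t t' : 'I_n' -> tm T m') :
    (forall i, reds (t i) (t' i)) -> forall i, reds (up t i) (up t' i).
  move=> r; apply: ord_case => [|i]; first by rewrite /up !scons0; exact: reds_refl.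
  by rewrite /up !scons_lift /shift !rename_as_subst; apply: reds_subst.
elim: M m s s' => {n} /= [n x|n c l IH|n u|n P IHP Q IHQ|n A IHA P IHP|n A IHA P IHP]
  m s s' r.
- exact: r.
- by apply: reds_Cst => i; apply: IH.
- exact: reds_refl.
- by apply: reds_App; [apply: IHP|apply: IHQ].
- by apply: reds_Lam; [apply: IHA|apply: IHP; apply: E].
- by apply: reds_Pi; [apply: IHA|apply: IHP; apply: E].
Qed.

End Reduction.

(** * Weakening and substitution for typing *)

Scheme wf_mut := Minimality for wf Sort Prop
with typ_mut := Minimality for typ Sort Prop
with args_mut := Minimality for args Sort Prop.
Combined Scheme wf_typ_args_ind from wf_mut, typ_mut, args_mut.

Section Typing.
Variable T : theory.

(** Weakening is proved for all such renamings because a binder turns [lift ord0] into a renaming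
    that inserts a variable in the middle of the context. *)
Definition ren_ok n m (D : ctx T n) (G : ctx T m) (r : 'I_n -> 'I_m) : Prop :=
  forall i, lookup G (r i) = rename r (lookup D i).

Lemma ren_ok_lift n (G : ctx T n) A : ren_ok G (Snoc G A) (lift ord0).
Proof. by move=> i; rewrite /= scons_lift. Qed.

Lemma ren_ok_up n m (D : ctx T n) (G : ctx T m) r A :
  ren_ok D G r -> ren_ok (Snoc D A) (Snoc G (rename r A)) (up_ren r).
Proof.
move=> ok; apply: ord_case => [|i] /=; rewrite rename_up_shift /up_ren.
  by rewrite !scons0.
by rewrite !scons_lift ok.
Qed.

(** Well-formedness of the target [G] is a hypothesis, hence the trivial [wf] component. Under a
    binder, the renamed premise [A : TYPE] makes the extended target well-formed. [E] is a closed
    context, which the renaming leaves unchanged. *)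
Lemma typ_args_rename :
  (forall n (D : ctx T n), wf D -> True) /\
  (forall n (D : ctx T n) M A, typ D M A ->
     forall m (G : ctx T m) r, wf G -> ren_ok D G r ->
     typ G (rename r M) (rename r A)) /\
  (forall n (D : ctx T n) k (l : 'I_k -> tm T n) E, args D l E ->
     forall m (G : ctx T m) r, wf G -> ren_ok D G r ->
     args G (fun i => rename r (l i)) E).
Proof.
apply: wf_typ_args_ind => //.
- move=> n D c l s tA _ _ IH m G r wG ok /=; rewrite rename_subst.
  by apply: typ_cons tA _; apply: IH.
- by move=> n D _ _ m G r wG ok; apply: typ_sort.
- by move=> n D x _ _ m G r wG ok; rewrite -ok; apply: typ_var.
- move=> n D M A B s _ IHM _ IHB cAB m G r wG ok.
  apply: typ_conv (IHM _ _ _ wG ok) (IHB _ _ _ wG ok) _.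
  by rewrite !rename_as_subst; apply: conv_subst.
- move=> n D A B s _ IHA _ IHB m G r wG ok /=.
  have tA := IHA _ _ _ wG ok.
  exact: (typ_prod (s := s) tA (IHB _ _ _ (wf_decl tA) (ren_ok_up _ ok))).
- move=> n D M N A B _ IHM _ IHN m G r wG ok; rewrite rename_subst1.
  exact: typ_app (IHM _ _ _ wG ok) (IHN _ _ _ wG ok).
- move=> n D A B M s _ IHA _ IHB _ IHM m G r wG ok /=.
  have tA := IHA _ _ _ wG ok; have wA := wf_decl tA.
  exact: typ_abs tA (IHB _ _ _ wA (ren_ok_up _ ok)) (IHM _ _ _ wA (ren_ok_up _ ok)).
- by move=> n D l _ _ m G r wG ok; apply: args_empty.
- move=> n D k l E A _ IHl _ IHA m G r wG ok.
  apply: args_snoc; first exact: IHl.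
  by rewrite -rename_subst; apply: IHA.
Qed.

Lemma args_wf n (G : ctx T n) k (l : 'I_k -> tm T n) D : args G l D -> wf G.
Proof. by elim. Qed.

(** Sequential typing substitutes only the earlier arguments; the shifts in [lookup] hide the later
    ones, so the whole list [l] can be substituted instead. *)
Lemma args_typ n (G : ctx T n) k (l : 'I_k -> tm T n) D : args G l D ->
  forall i, typ G (l i) (subst l (lookup D i)).
Proof.
elim=> {n G k l D} [n G l _ []|n G k l D A _ IH tl] //.
have E B : subst l (shift B) = subst (fun i => l (lift ord0 i)) B.
  exact: subst_rename.
by apply: ord_case => [|i] /=; rewrite E ?scons0 ?scons_lift.
Qed.

(** Takes the substitution lemma under a binder: the old arguments are weakened and the new one is
    the bound variable. *)
Lemma args_up n (G : ctx T n) k (l : 'I_k -> tm T n) D A :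
  args G l D -> wf (Snoc G (subst l A)) ->
  args (Snoc G (subst l A)) (up l) (Snoc D A).
Proof.
move=> al wG.
have El : (fun i => up l (lift ord0 i)) = (fun i => shift (l i)).
  by apply: functional_extensionality => i; rewrite /up scons_lift.
apply: args_snoc; rewrite El.
  exact: (typ_args_rename.2.2 _ _ _ _ _ al _ _ _ wG (@ren_ok_lift _ _ _)).
(* Substituting the shifted arguments in [A] is shifting [subst l A], which is the type that
   [lookup] gives to the new variable. *)
rewrite /up scons0 -[X in typ _ _ X](rename_subst A l (lift ord0)).
have := typ_var ord0 wG.
by rewrite /= scons0.
Qed.

(** A list typed against [D] is exactly a well-typed substitution out of [D]: [args_typ] settles
    variables, [args_up] binders, and [args_wf] the rules asking for a well-formed context. *)
Lemma typ_args_subst :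
  (forall n (D : ctx T n), wf D -> True) /\
  (forall n (D : ctx T n) M A, typ D M A ->
     forall m (G : ctx T m) s, args G s D -> typ G (subst s M) (subst s A)) /\
  (forall n (D : ctx T n) k (l : 'I_k -> tm T n) E, args D l E ->
     forall m (G : ctx T m) s, args G s D ->
     args G (fun i => subst s (l i)) E).
Proof.
apply: wf_typ_args_ind => //.
- move=> n D c l u tA _ _ IH m G s aG /=; rewrite subst_subst.
  by apply: typ_cons tA _; apply: IH.
- by move=> n D _ _ m G s /args_wf wG; apply: typ_sort.
- by move=> n D x _ _ m G s /args_typ; apply.
- move=> n D M A B u _ IHM _ IHB cAB m G s aG.
  by apply: typ_conv (IHM _ _ _ aG) (IHB _ _ _ aG) _; apply: conv_subst.
- move=> n D A B u _ IHA _ IHB m G s aG /=.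
  have tA := IHA _ _ _ aG.
  exact: (typ_prod (s := u) tA (IHB _ _ _ (args_up aG (wf_decl tA)))).
- move=> n D M N A B _ IHM _ IHN m G s aG; rewrite subst_subst1.
  exact: typ_app (IHM _ _ _ aG) (IHN _ _ _ aG).
- move=> n D A B M u _ IHA _ IHB _ IHM m G s aG /=.
  have tA := IHA _ _ _ aG; have aA := args_up aG (wf_decl tA).
  exact: typ_abs tA (IHB _ _ _ aA) (IHM _ _ _ aA).
- by move=> n D l _ _ m G s /args_wf wG; apply: args_empty.
- move=> n D k l E A _ IHl _ IHA m G s aG.
  apply: args_snoc; first exact: IHl.
  by rewrite -subst_subst; apply: IHA.
Qed.

End Typing.

(** * Translation *)

Section Translation.
Variables (K1 K2 : constants) (F : premorphism K1 K2).

(** The free variables of [F c] are argument positions, all replaced by the translated arguments, so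
    the renaming acts on those alone. *)
Lemma tr_rename n (M : tm K1 n) m (r : 'I_n -> 'I_m) :
  tr F (rename r M) = rename r (tr F M).
Proof.
elim: M m r => {n} //= [n c l IH|n P IHP Q IHQ|n A IHA P IHP|n A IHA P IHP] m r.
- rewrite rename_subst; congr subst.
  by apply: functional_extensionality => i.
- by rewrite IHP IHQ.
- by rewrite IHA IHP.
- by rewrite IHA IHP.
Qed.

Lemma tr_subst n (M : tm K1 n) m (s : 'I_n -> tm K1 m) :
  tr F (subst s M) = subst (fun i => tr F (s i)) (tr F M).
Proof.
have E n' m' (t : 'I_n' -> tm K1 m') :
    up (fun i => tr F (t i)) = fun i => tr F (up t i).
  apply: eq_scons => [|i]; rewrite /up ?scons0 ?scons_lift //.
  exact: tr_rename.
elim: M m s => {n} //= [n c l IH|n P IHP Q IHQ|n A IHA P IHP|n A IHA P IHP] m s.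
- rewrite subst_subst; congr subst.
  by apply: functional_extensionality => i.
- by rewrite IHP IHQ.
- by rewrite IHA IHP (E _ _ s).
- by rewrite IHA IHP (E _ _ s).
Qed.

Lemma tr_subst1 n (N : tm K1 n) (M : tm K1 n.+1) :
  tr F (subst1 N M) = subst1 (tr F N) (tr F M).
Proof.
rewrite /subst1 tr_subst; congr subst; symmetry.
by apply: eq_scons => [|i]; rewrite ?scons0 ?scons_lift.
Qed.

Lemma tr_lookup n (G : ctx K1 n) i : tr F (lookup G i) = lookup (tr_ctx F G) i.
Proof.
elim: G i => [|n' G IH A] //=; apply: ord_case => [|i].
  by rewrite !scons0; apply: tr_rename.
by rewrite !scons_lift -IH; apply: tr_rename.
Qed.

End Translation.

(** * Preservation of reduction, conversion and typing along a morphism *)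

Section Morphism.
Variables (T1 T2 : theory) (F : premorphism T1 T2).
Hypothesis hF : @morphism T1 T2 F.

(** One step may become none or several: a morphism gives only [reds] for a rule, and [F c] may drop
    or duplicate an argument. *)
Lemma tr_red n (M N : tm T1 n) : red M N -> @reds T2 n (tr F M) (tr F N).
Proof.
elim=> {n M N}.
- move=> n A M N; rewrite tr_subst1; apply: rt_step; exact: red_beta.
- move=> k c l r n s lr; rewrite !tr_subst; apply: reds_subst.
  exact: morphism_red lr.
(* Away from position [i] the arguments agree and take zero steps. *)
- move=> n c l l' i _ IH E; apply: reds_subst_pointwise => j.
  by case: (eqVneq j i) => [->|/E ->] //; apply: reds_refl.
- by move=> n M M' N _ IH; apply: reds_App => //; apply: reds_refl.
- by move=> n M M' N _ IH; apply: reds_App => //; apply: reds_refl.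
- by move=> n A A' M _ IH; apply: reds_Lam => //; apply: reds_refl.
- by move=> n A M M' _ IH; apply: reds_Lam => //; apply: reds_refl.
- by move=> n A A' B _ IH; apply: reds_Pi => //; apply: reds_refl.
- by move=> n A B B' _ IH; apply: reds_Pi => //; apply: reds_refl.
Qed.

Lemma tr_conv n (M N : tm T1 n) : conv M N -> @conv T2 n (tr F M) (tr F N).
Proof.
elim=> [P Q /tr_red /reds_conv //|P|P Q _|P Q S _ IH1 _ IH2].
- exact: rst_refl.
- exact: rst_sym.
- exact: rst_trans IH1 IH2.
Qed.

(** The component on [args] makes the mutual induction go through: in the constant case it provides
    the well-typed substitution to apply to the typing of [F c]. *)
Lemma tr_wf_typ_args :
  (forall n (G : ctx T1 n), wf G -> @wf T2 n (tr_ctx F G)) /\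
  (forall n (G : ctx T1 n) M A, typ G M A ->
     @typ T2 n (tr_ctx F G) (tr F M) (tr F A)) /\
  (forall n (G : ctx T1 n) k (l : 'I_k -> tm T1 n) D, args G l D ->
     @args T2 n (tr_ctx F G) k (fun i => tr F (l i)) (tr_ctx F D)).
Proof.
apply: wf_typ_args_ind => /=.
- exact: wf_empty.
- by move=> n G A _; apply: wf_decl.
- move=> n G c l s _ _ _ al; rewrite tr_subst.
  exact: (typ_args_subst T2).2.1 (morphism_typ hF c) _ _ _ al.
- by move=> n G _; apply: typ_sort.
- by move=> n G x _ wG; rewrite tr_lookup; apply: typ_var.
- by move=> n G M A B s _ tM _ tB /tr_conv; apply: typ_conv tM tB.
- by move=> n G A B s _ tA _ tB; apply: typ_prod tA tB.
- by move=> n G M N A B _ tM _ tN; rewrite tr_subst1; apply: typ_app tM tN.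
- by move=> n G A B M s _ tA _ tB _ tM; apply: typ_abs tA tB tM.
- by move=> n G l _; apply: args_empty.
- move=> n G k l D A _ al _ tl; apply: args_snoc => //.
  by rewrite -tr_subst.
Qed.

End Morphism.

Theorem mainTheorem18 (T1 T2 : theory) (F : premorphism T1 T2)
    (hF : @morphism T1 T2 F) :
  (forall (n : nat) (G : ctx T1 n), @wf T1 n G -> @wf T2 n (tr_ctx F G)) /\
  (forall (n : nat) (G : ctx T1 n) (M A : tm T1 n),
     @typ T1 n G M A -> @typ T2 n (tr_ctx F G) (tr F M) (tr F A)).
Proof. by have [tr_wf [tr_typ _]] := tr_wf_typ_args hF. Qed.
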